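(* Let $k$ be a perfect field of characteristic $p>0$, $S=k[[x_1,\ldots,x_n]]$, $q=p^e$ with $e\geq 1$, $I\subsetneq S$ a square-free monomial ideal, and $R=S/I$. Let $\phi:R^{1/q}\to R$ be the $R$-linear map given by $z=(\prod_{i=1}^n x_i)^{q-1}$, that is, $\phi=\Phi/I$ with $\Phi(s)=\Phi_S\big((\prod_{i=1}^n x_i)^{(q-1)/q}s\big)$ for all $s\in S^{1/q}$, where $\Phi_S$ is the trace map. Then the test ideal associated to the pair $(R,\phi)$ is $$\tau(R,\phi)=(x_F:\ F\in\mathcal F(\Delta)),$$ the ideal of $R$ generated by the images of the monomials $x_F$, where $\Delta$ is the simplicial complex associated to $I$ and $\mathcal F(\Delta)$ is its set of facets.
   Context: $S^{1/q}$ is the ring of $q$-th roots of elements of $S$; it is a free $S$-module with basis $\{x_1^{\lambda_1/q}\cdots x_n^{\lambda_n/q}\}_{0\le\lambda_i\le q-1}$. The trace map $\Phi_S:S^{1/q}\to S$ is the $S$-linear map sending $x_1^{(q-1)/q}\cdots x_n^{(q-1)/q}$ to $1$ and all the other basis elements to $0$. $R$ is reduced and $R^{1/q}=S^{1/q}/I^{1/q}$ is its ring of $q$-th roots; for an ideal $J$, $J^{1/q}$ is the set of $q$-th roots of elements of $J$. The notation $\phi=\Phi/I$ means that $\Phi(I^{1/q})\subseteq I$ and $\phi$ is the induced map $S^{1/q}/I^{1/q}\to S/I$. $R^o$ is the complement of the union of the minimal primes of $R$. An ideal $J$ of $R$ is $\phi$-compatible if $\phi(J^{1/q})\subseteq J$.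 The test ideal $\tau(R,\phi)$ is the unique smallest (with respect to inclusion) $\phi$-compatible ideal $J$ of $R$ with $J\cap R^o\neq\emptyset$. For $F\subseteq[n]=\{1,\dots,n\}$ put $x_F=\prod_{i\in F}x_i$. The simplicial complex $\Delta$ on $[n]$ associated to $I$ is the one whose faces are the $F\subseteq[n]$ with $x_F\notin I$; thus $I=(x_F: F\notin\Delta)$. Facets are faces maximal under inclusion. *)

(* Defs.v *)
From HB Require Import structures.
From mathcomp Require Import all_boot all_order all_algebra.
From mathcomp Require Import ring_quotient mpoly boolp classical_sets.

Set Implicit Arguments.
Unset Strict Implicit.
Unset Printing Implicit Defensive.

Import GRing.Theory.
Local Open Scope ring_scope.
Local Open Scope quotient_scope.

(* The formal power series ring k[[x_1, ..., x_n]]: all functions from the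
   monomials 'X_{1..n} to k, with the Cauchy product. *)

Record mpseries (n : nat) (k : comNzRingType) :=
  MPSeries { mpscoef :> 'X_{1..n} -> k }.

HB.instance Definition _ n k := [isNew for @mpscoef n k].
HB.instance Definition _ n k := [Choice of mpseries n k by <:].

Section PowerSeries.
Context {n : nat} {k : comNzRingType}.
Implicit Types (f g h : mpseries n k) (m : 'X_{1..n}).

Lemma mpseriesP f g : (forall m, f m = g m) -> f = g.
Proof. by move=> fg; apply: val_inj; apply: funext. Qed.

Definition mps_zero : mpseries n k := MPSeries (fun=> 0).
Definition mps_opp f : mpseries n k := MPSeries (fun m => - f m).
Definition mps_add f g : mpseries n k := MPSeries (fun m => f m + g m).

Fact mps_addA : associative mps_add.
Proof. by move=> f g h; apply: mpseriesP => m; exact: addrA. Qed.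
Fact mps_addC : commutative mps_add.
Proof. by move=> f g; apply: mpseriesP => m; exact: addrC. Qed.
Fact mps_add0 : left_id mps_zero mps_add.
Proof. by move=> f; apply: mpseriesP => m; exact: add0r. Qed.
Fact mps_addN : left_inverse mps_zero mps_opp mps_add.
Proof. by move=> f; apply: mpseriesP => m; exact: addNr. Qed.

HB.instance Definition _ := GRing.isZmodule.Build (mpseries n k)
  mps_addA mps_addC mps_add0 mps_addN.

Definition mps_monom (u : 'X_{1..n}) : mpseries n k :=
  MPSeries (fun m => (m == u)%:R).

Definition mps_mul f g : mpseries n k :=
  MPSeries (fun m =>
    \sum_(u : 'X_{1..n < (mdeg m).+1} | (u <= m)%MM) f u * g (m - u)%MM).

Definition mps_trunc (d : nat) f : {mpoly k[n]} :=
  \sum_(u : 'X_{1..n < d}) f u *: 'X_[u].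

Lemma mcoeff_trunc d f m : (mdeg m < d)%N -> (mps_trunc d f)@_m = f m.
Proof. exact: mcoeff_mpoly. Qed.

Lemma lem_mdeg (u m : 'X_{1..n}) : (u <= m)%MM -> (mdeg u <= mdeg m)%N.
Proof. by move=> um; rewrite -(submK um) mdegD leq_addl. Qed.

Lemma mcoeff_mul_eq (P Q P' Q' : {mpoly k[n]}) m :
    (forall u, (u <= m)%MM -> P@_u = P'@_u) ->
    (forall u, (u <= m)%MM -> Q@_u = Q'@_u) ->
  (P * Q)@_m = (P' * Q')@_m.
Proof.
move=> PP QQ; rewrite !(mcoeff_poly_mul_lin _ _ (ltnSn (mdeg m))).
apply: eq_bigr => u um; rewrite PP // QQ //.
by apply/mnm_lepP => i; rewrite mnmBE leq_subr.
Qed.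

Lemma mps_mulE d f g m : (mdeg m < d)%N ->
  mps_mul f g m = (mps_trunc d f * mps_trunc d g)@_m.
Proof.
move=> md; rewrite (mcoeff_poly_mul_lin _ _ (ltnSn (mdeg m))).
have le_d u : (u <= m)%MM -> (mdeg u < d)%N.
  by move=> um; apply: leq_ltn_trans md; apply: lem_mdeg.
apply: eq_bigr => u um; rewrite !mcoeff_trunc ?le_d //.
by apply/mnm_lepP => i; rewrite mnmBE leq_subr.
Qed.

Lemma mps_trunc_mul d f g m : (mdeg m < d)%N ->
  (mps_trunc d (mps_mul f g))@_m = (mps_trunc d f * mps_trunc d g)@_m.
Proof. by move=> md; rewrite mcoeff_trunc // (mps_mulE _ _ md). Qed.

Fact mps_mulA : associative mps_mul.
Proof.
move=> f g h; apply: mpseriesP => m; have md := ltnSn (mdeg m).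
have le_d u : (u <= m)%MM -> (mdeg u < (mdeg m).+1)%N by move/lem_mdeg.
rewrite !(mps_mulE _ _ md).
transitivity ((mps_trunc (mdeg m).+1 f *
    (mps_trunc (mdeg m).+1 g * mps_trunc (mdeg m).+1 h))@_m).
  by apply: mcoeff_mul_eq => // u /le_d; apply: mps_trunc_mul.
by rewrite mulrA; apply: mcoeff_mul_eq => // u /le_d ud; rewrite mps_trunc_mul.
Qed.

Fact mps_mulC : commutative mps_mul.
Proof.
move=> f g; apply: mpseriesP => m.
by rewrite !(mps_mulE _ _ (ltnSn _)) mulrC.
Qed.

Lemma mps_trunc_monom d u : (mdeg u < d)%N -> mps_trunc d (mps_monom u) = 'X_[u].
Proof.
move=> ud; apply/mpolyP => m; rewrite mcoeffX.
case: (ltnP (mdeg m) d) => md; first by rewrite mcoeff_trunc //= eq_sym.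
rewrite /mps_trunc raddf_sum /= big1 => [|v _].
  by case: eqP => // E; move: md; rewrite -E leqNgt ud.
rewrite mcoeffZ mcoeffX; case: (_ =P m) => [E|]; last by rewrite mulr0.
by move: md; rewrite -E leqNgt bmdeg.
Qed.

Fact mps_mul1 : left_id (mps_monom 0%MM) mps_mul.
Proof.
move=> f; apply: mpseriesP => m; rewrite (mps_mulE _ _ (ltnSn _)).
rewrite mps_trunc_monom ?mdeg0 // mpolyX0 mul1r.
exact: mcoeff_trunc.
Qed.

Fact mps_mulDl : left_distributive mps_mul +%R.
Proof.
move=> f g h; apply: mpseriesP => m /=.
by rewrite -big_split; apply: eq_bigr => u _; rewrite /= mulrDl.
Qed.

Fact mps_1neq0 : mps_monom 0%MM != 0.
Proof.
apply/eqP => /(congr1 (fun f : mpseries n k => f 0%MM))/eqP /=.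
by rewrite eqxx oner_eq0.
Qed.

HB.instance Definition _ := GRing.Zmodule_isComNzRing.Build (mpseries n k)
  mps_mulA mps_mulC mps_mul1 mps_mulDl mps_1neq0.

Definition mps_X (i : 'I_n) : mpseries n k := mps_monom U_(i)%MM.

Definition mps_XF (F : {set 'I_n}) : mpseries n k := \prod_(i in F) mps_X i.

Lemma mpsMn f j m : (f *+ j) m = f m *+ j.
Proof. by elim: j => [|j IHj] //; rewrite !mulrS -IHj. Qed.

Lemma mps_pchar p : p \in [pchar k] -> p \in [pchar (mpseries n k)].
Proof.
move=> chp; rewrite inE (pcharf_prime chp); apply/eqP/mpseriesP => m.
by rewrite mpsMn mulrn_pchar.
Qed.

Lemma mps_exprE d f j m : (mdeg m < d)%N -> (f ^+ j) m = (mps_trunc d f ^+ j)@_m.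
Proof.
elim: j m => [|j IHj] m md; first by rewrite expr0 mcoeff1.
rewrite !exprS [LHS](mps_mulE _ _ md).
apply: mcoeff_mul_eq => // u /lem_mdeg um; have ud := leq_ltn_trans um md.
by rewrite mcoeff_trunc // IHj.
Qed.

End PowerSeries.

Arguments mps_pchar n {k p} chp.
Arguments mps_X {n} k i.
Arguments mps_XF {n} k F.

(* The ring A^{1/q} of q-th roots, q = p ^ e, of a (reduced) ring A of
   characteristic p.  Taking q-th roots is a ring isomorphism from A onto
   A^{1/q}, so A^{1/q} is encoded as a copy of A in which the element a stands
   for its root a^{1/q}.  Under this encoding the inclusion of A in A^{1/q}
   sends b to (b ^+ q)^{1/q}, whence the A-module structure
   b *: a^{1/q} = (b ^+ q * a)^{1/q}. *)
Definition root_ring (A : comNzRingType) (p : nat) (chA : p \in [pchar A])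
  (e : nat) : Type := A.

Section RootRing.
Context {A : comNzRingType} {p : nat} (chA : p \in [pchar A]) (e : nat).
Local Notation q := (p ^ e)%N.
Local Notation rA := (root_ring chA e).

HB.instance Definition _ := GRing.ComNzRing.copy rA A.

Definition qroot (a : A) : rA := a.
Definition unqroot (t : rA) : A := t.

HB.instance Definition _ := GRing.RMorphism.copy qroot (@idfun A).
HB.instance Definition _ := GRing.RMorphism.copy unqroot (@idfun A).

Lemma qrootK : cancel qroot unqroot. Proof. by []. Qed.
Lemma unqrootK : cancel unqroot qroot. Proof. by []. Qed.

Definition root_scale (b : A) (t : rA) : rA := qroot (b ^+ q * unqroot t).

Lemma exprqD (b c : A) : (b + c) ^+ q = b ^+ q + c ^+ q.
Proof. by apply: exprDn_pchar; rewrite pnatX (pnatE _ (pcharf_prime chA)) chA. Qed.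

Fact root_scaleA b c t : root_scale b (root_scale c t) = root_scale (b * c) t.
Proof. by rewrite /root_scale qrootK mulrA exprMn. Qed.
Fact root_scale1 : left_id 1 root_scale.
Proof. by move=> t; rewrite /root_scale expr1n mul1r unqrootK. Qed.
Fact root_scaleDr : right_distributive root_scale +%R.
Proof. by move=> b s t; rewrite /root_scale -rmorphD -mulrDr -rmorphD. Qed.
Fact root_scaleDl t : {morph root_scale^~ t : b c / b + c}.
Proof. by move=> b c; rewrite /root_scale exprqD mulrDl rmorphD. Qed.

HB.instance Definition _ := GRing.Zmodule_isLmodule.Build A rA
  root_scaleA root_scale1 root_scaleDr root_scaleDl.

Fact root_scaleAl (b : A) (s t : rA) : b *: (s * t) = (b *: s) * t.
Proof. exact: mulrA. Qed.
HB.instance Definition _ := GRing.Lmodule_isLalgebra.Build A rA root_scaleAl.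
HB.instance Definition _ := GRing.Lalgebra_isComAlgebra.Build A rA.

Lemma qrootX a : qroot a ^+ q = a%:A.
Proof. by rewrite -rmorphXn -[RHS]/(qroot (a ^+ q * 1)) mulr1. Qed.

Lemma root_ringX_in (t : rA) : t ^+ q = (unqroot t)%:A.
Proof. exact: qrootX. Qed.

Lemma root_ring_inj : (forall (a : A) j, a ^+ j = 0 -> a = 0) ->
  injective (fun a : A => a%:A : rA).
Proof.
move=> redA a b /eqP; rewrite -subr_eq0 -scalerBl => /eqP E.
apply/eqP; rewrite -subr_eq0; apply/eqP/(redA _ q).
by rewrite -[RHS]E -[RHS]/((a - b) ^+ q * 1) mulr1.
Qed.

End RootRing.

Lemma quot_pchar {A : comNzRingType} {p : nat} (chA : p \in [pchar A])
  (I : idealr A) : p \in [pchar {ideal_quot I}].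
Proof. exact: (rmorph_pchar (\pi_{ideal_quot I}) chA). Qed.

Local Open Scope classical_set_scope.

Section Ideals.
Context {A : comNzRingType}.

Definition is_ideal (J : set A) : Prop :=
  J 0 /\ forall a x y, J x -> J y -> J (a * x + y).

Definition gen_ideal (G : set A) : set A := smallest is_ideal G.

Definition is_prime (P : set A) : Prop :=
  [/\ is_ideal P, ~ P 1 & forall x y, P (x * y) -> P x \/ P y].

Definition is_minimal_prime (P : set A) : Prop :=
  is_prime P /\ forall Q, is_prime Q -> Q `<=` P -> P `<=` Q.

Definition minimal_primes_compl : set A :=
  [set x | forall P, is_minimal_prime P -> ~ P x].

Lemma gen_ideal_is_ideal G : is_ideal (gen_ideal G).
Proof.
split=> [J [[]]//|a x y xG yG J JG].
by case: (JG) => -[_ addJ] _; apply: addJ; [apply: xG|apply: yG].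
Qed.

Lemma sub_gen_ideal (G : set A) : G `<=` gen_ideal G.
Proof. exact: sub_gen_smallest. Qed.

End Ideals.

Section TestIdeal.
Context {A : comNzRingType} {p : nat} (chA : p \in [pchar A]) (e : nat).

Definition root_ideal (J : set A) : set (root_ring chA e) :=
  [set qroot chA e x | x in J].

Definition is_compatible (phi : root_ring chA e -> A) (J : set A) : Prop :=
  phi @` root_ideal J `<=` J.

(* tau is the smallest compatible ideal meeting the complement of the minimal
   primes; such a tau is unique, being least for inclusion. *)
Definition is_test_ideal (phi : root_ring chA e -> A) (tau : set A) : Prop :=
  let admissible (J : set A) :=
    [/\ is_ideal J, is_compatible phi J & J `&` minimal_primes_compl !=set0] in
  admissible tau /\ forall J, admissible J -> tau `<=` J.

End TestIdeal.

Arguments root_ideal {A p} chA e J _.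

Section QuotientMap.
Context {A : comNzRingType} {p : nat} (chA : p \in [pchar A]) (e : nat).
Variable I : idealr A.
Local Notation R := {ideal_quot I}.

Definition root_proj (t : root_ring chA e) : root_ring (quot_pchar chA I) e :=
  qroot (quot_pchar chA I) e (\pi_R (unqroot t)).

Lemma root_proj_surj : forall u, exists t, root_proj t = u.
Proof. by move=> u; exists (repr (unqroot u)); rewrite /root_proj reprK. Qed.

Lemma root_proj_eq s t :
  root_proj s = root_proj t <-> root_ideal chA e [set` I] (s - t).
Proof.
split=> [/eqP E|[x xI xE]].
  exists (unqroot (s - t)) => //=.
  by rewrite raddfB /= Quotient.idealrBE.
apply/eqP; rewrite -[_ == _]/(unqroot s == unqroot t %[mod R]).
by rewrite -Quotient.idealrBE -raddfB /= -xE.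
Qed.

(* phi = Phi / I, with S^{1/q} / I^{1/q} identified with R^{1/q} by root_proj,
   which is surjective with kernel I^{1/q}. *)
Definition is_quotient_map (Phi : root_ring chA e -> A)
    (phi : root_ring (quot_pchar chA I) e -> R) : Prop :=
  Phi @` root_ideal chA e [set` I] `<=` [set` I] /\
  forall t, phi (root_proj t) = \pi_R (Phi t).

End QuotientMap.

Section MonomialIdeals.
Context {n : nat} {k : comNzRingType}.
Local Notation S := (mpseries n k).

Definition squarefree_monomial_ideal (I : set S) : Prop :=
  exists G : set {set 'I_n}, I = gen_ideal [set mps_XF k F | F in G].

Definition is_face (I : idealr S) : pred {set 'I_n} :=
  [pred F | mps_XF k F \notin I].

Definition is_facet (I : idealr S) : pred {set 'I_n} := maxset (is_face I).

End MonomialIdeals.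

Definition perfect_char (p : nat) (k : fieldType) : Prop :=
  forall a : k, exists b, b ^+ p = a.

Section Trace.
Context {n : nat} {k : comNzRingType} {p : nat}.
Variables (chS : p \in [pchar (mpseries n k)]) (e : nat).
Local Notation S := (mpseries n k).
Local Notation q := (p ^ e)%N.

Definition is_trace (PhiS : root_ring chS e -> S) : Prop :=
  forall l : 'I_n -> nat, (forall i, (l i < q)%N) ->
    PhiS (\prod_i qroot chS e (mps_X k i) ^+ l i)
      = if [forall i, l i == q.-1] then 1 else 0.

(* The map s |-> PhiS (z^{1/q} * s). *)
Definition twist (PhiS : root_ring chS e -> S) (z : S) (s : root_ring chS e) : S :=
  PhiS (qroot chS e z * s).

End Trace.

Section Existence.
Context {n : nat} {k : fieldType} {p : nat} (chk : p \in [pchar k]) (e : nat).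
Local Notation S := (mpseries n k).
Local Notation q := (p ^ e)%N.
Local Notation chS := (mps_pchar n chk).
Local Notation Phi PhiS := (twist PhiS ((\prod_(i < n) mps_X k i) ^+ q.-1)).

Let q_gt0 : (0 < q)%N.
Proof. by rewrite expn_gt0 prime_gt0 // (pcharf_prime chk). Qed.

Lemma mps_XF_subset (F : {set 'I_n}) :
  exists g, \prod_(i < n) mps_X k i = mps_XF k F * g.
Proof.
exists (\prod_(i | i \notin F) mps_X k i).
by rewrite (bigID (mem F)) /=.
Qed.

Lemma twist_ideal (I : idealr S) (PhiS : {linear root_ring chS e -> S^o}) :
    squarefree_monomial_ideal [set` I] ->
  Phi PhiS @` root_ideal chS e [set` I] `<=` [set` I].
Proof.
case=> G IE x [_ [s sI <-] <-] {x}.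
pose J : set S := [set s | forall g, Phi PhiS (qroot chS e (g * s)) \in I].
suff: gen_ideal [set mps_XF k F | F in G] `<=` J.
  by rewrite -IE => /(_ s sI 1); rewrite mul1r.
apply: smallest_sub.
  split=> [g|a x y xJ yJ g]; first by rewrite mulr0 /twist rmorph0 mulr0 linear0 rpred0.
  rewrite mulrDr rmorphD /twist mulrDr linearD rpredD // ?yJ //.
  by rewrite mulrA; exact: xJ.
move=> _ [F FG <-] g; rewrite /twist -rmorphM.
have [h ->] := mps_XF_subset F; set x := mps_XF k F.
rewrite [X in PhiS X](_ : _ = x *: qroot chS e (h ^+ q.-1 * g)); last first.
  rewrite -[RHS]/(qroot chS e (x ^+ q * (h ^+ q.-1 * g))); congr (qroot _ _ _).
  rewrite exprMn (_ : x ^+ q = x ^+ q.-1 * x); last by rewrite -exprSr prednK.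
  by rewrite (mulrC g) mulrACA.
rewrite (linearZ_LR PhiS) /= -[_ *: _]/(x * _) mulrC idealMr //.
have : gen_ideal [set mps_XF k F | F in G] x by apply: sub_gen_ideal; exists F.
by rewrite -IE.
Qed.

Lemma quotient_map_exists (I : idealr S)
    (PhiS : {linear root_ring chS e -> S^o}) :
    squarefree_monomial_ideal [set` I] ->
  exists phi : {linear root_ring (quot_pchar chS I) e -> {ideal_quot I}^o},
    is_quotient_map (Phi PhiS) phi.
Proof.
move=> sqI; have subI := twist_ideal (PhiS := PhiS) sqI.
pose phi (u : root_ring (quot_pchar chS I) e) : {ideal_quot I}^o :=
  \pi_{ideal_quot I} (Phi PhiS (qroot chS e (repr (unqroot u)))).
have PhiB s t : Phi PhiS (s - t) = Phi PhiS s - Phi PhiS t.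
  by rewrite /twist mulrBr linearB.
have phiE t : phi (root_proj I t) = \pi_{ideal_quot I} (Phi PhiS t).
  apply/eqP; rewrite -Quotient.idealrBE -PhiB; apply: subI.
  eexists; last by [].
  by apply/root_proj_eq; rewrite /root_proj !qrootK reprK.
have phiL : linear phi.
  move=> a u v; have [s <-] := root_proj_surj u; have [t <-] := root_proj_surj v.
  have -> : a *: root_proj I s + root_proj I t
      = root_proj I (repr a *: s + t).
    rewrite /root_proj -[in LHS](reprK a) -[_ *: qroot _ _ _]/(qroot (quot_pchar chS I) e
      (\pi_{ideal_quot I} (repr a) ^+ q * \pi_{ideal_quot I} (unqroot s))).
    by rewrite -rmorphXn -rmorphM -!rmorphD.
  rewrite !phiE -[in RHS](reprK a) /twist mulrDr linearD -scalerAr (linearZ_LR PhiS).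
  by rewrite rmorphD; congr (_ + _); apply: rmorphM.
pose phiM := GRing.isLinear.Build _ _ _ _ phi phiL.
pose phi' : {linear root_ring (quot_pchar chS I) e -> {ideal_quot I}^o} := HB.pack phi phiM.
by exists phi'; split.
Qed.

Lemma mps_monomD (u v : 'X_{1..n}) :
  mps_monom (u + v)%MM = mps_monom u * mps_monom v :> S.
Proof.
apply: mpseriesP => m; pose d := (mdeg m + mdeg u + mdeg v).+1.
have md : (mdeg m < d)%N by rewrite ltnS -addnA leq_addr.
have ud : (mdeg u < d)%N by rewrite ltnS -addnA addnCA leq_addr.
have vd : (mdeg v < d)%N by rewrite ltnS leq_addl.
rewrite [RHS](mps_mulE _ _ md) !mps_trunc_monom // -mpolyXD mcoeffX.
by rewrite eq_sym.
Qed.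

Lemma mps_monomX (u : 'X_{1..n}) j :
  mps_monom u ^+ j = mps_monom (u *+ j)%MM :> S.
Proof. by elim: j => [|j IHj]; rewrite ?expr0 // exprS IHj mulmS mps_monomD. Qed.

Lemma mps_monom_sum (u : 'I_n -> 'X_{1..n}) :
  mps_monom (\sum_i u i)%MM = \prod_i mps_monom (u i) :> S.
Proof. by apply: (big_morph (fun u => mps_monom u : S)) => // ? ?; apply: mps_monomD. Qed.

Lemma mcoeffXM (v m : 'X_{1..n}) (P : {mpoly k[n]}) :
  ('X_[v] * P)@_m = if (v <= m)%MM then P@_(m - v) else 0.
Proof.
case: ifP => vm.
  by rewrite mulrC -[in LHS](submK vm) addmC mcoeffMX.
rewrite (mcoeff_poly_mul_lin _ _ (ltnSn _)) big1 // => u um.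
rewrite mcoeffX; case: eqP => [vu|_]; last by rewrite mul0r.
by rewrite vu um in vm.
Qed.

Lemma mcoeff_trunc_mul d f (P : {mpoly k[n]}) (m : 'X_{1..n}) :
  (mps_trunc d f * P)@_m
    = \sum_(v : 'X_{1..n < d} | (v <= m)%MM) f v * P@_(m - v).
Proof.
rewrite /mps_trunc mulr_suml raddf_sum /= [RHS]big_mkcond.
apply: eq_bigr => v _; rewrite -scalerAl mcoeffZ mcoeffXM.
by case: ifP; rewrite ?mulr0.
Qed.

Lemma mps_truncXq d (f : S) :
  mps_trunc d f ^+ q = \sum_(v : 'X_{1..n < d}) (f v ^+ q) *: 'X_[(v *+ q)].
Proof.
have chP : p \in [pchar {mpoly k[n]}] by apply: (rmorph_pchar (@mpolyC n k) chk).
rewrite /mps_trunc (big_morph (fun P : {mpoly k[n]} => P ^+ q)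
  (exprqD chP e) (id1 := 0)); last by rewrite expr0n (gtn_eqF q_gt0).
by apply: eq_bigr => v _; rewrite exprZn mpolyXn.
Qed.

Lemma trace_exists : perfect_char p k ->
  exists PhiS : {linear root_ring chS e -> S^o}, is_trace PhiS.
Proof.
move=> perf.
have perfq (a : k) : exists b, b ^+ q = a.
  elim: (e) a => [|j IHj] a; first by exists a; rewrite expn0.
  have [b ba] := perf a; have [c cb] := IHj b.
  by exists c; rewrite expnSr exprM cb.
have [rt rtK] := choice perfq.
have Xq_inj : injective (fun a : k => a ^+ q).
  move=> a b /eqP; rewrite -subr_eq0; have -> : a ^+ q - b ^+ q = (a - b) ^+ q.
    by apply/eqP; rewrite subr_eq -(exprqD chk) subrK.
  by rewrite expf_eq0 q_gt0 subr_eq0 => /eqP.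
have rtX a : rt (a ^+ q) = a by apply: Xq_inj; rewrite /= rtK.
pose c : 'X_{1..n} := [multinom q.-1 | i < n].
pose tr (s : root_ring chS e) : S^o :=
  MPSeries (fun m => rt (unqroot s (m *+ q + c)%MM)).
have trL : linear tr.
  move=> b s t; apply: mpseriesP => m; apply: Xq_inj => /=.
  set M := (m *+ q + c)%MM.
  rewrite rtK -[LHS]/((b ^+ q * unqroot s) M + unqroot t M).
  rewrite -[RHS]/(((b * tr s : S) m + tr t m) ^+ q) (exprqD chk) rtK; congr (_ + _).
  pose d := (mdeg M).+1; have Md : (mdeg M < d)%N by [].
  have mM : (m <= M)%MM.
    apply/mnm_lepP => i; rewrite mnmDE mulmnE.
    by apply: leq_trans (leq_addr _ _); rewrite leq_pmulr.
  have md : (mdeg m < d)%N by apply: leq_ltn_trans Md; apply: lem_mdeg.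
  rewrite [(b * _) m](mps_mulE _ _ md) [LHS](mps_mulE _ _ Md).
  transitivity ((mps_trunc d b ^+ q * mps_trunc d (unqroot s))@_M).
    apply: mcoeff_mul_eq => // u /lem_mdeg uM; have ud := leq_ltn_trans uM Md.
    by rewrite mcoeff_trunc // (mps_exprE _ _ ud).
  rewrite mcoeff_trunc_mul mps_truncXq mulr_suml raddf_sum /=.
  rewrite (big_morph (fun a : k => a ^+ q) (exprqD chk e) (id1 := 0)); last first.
    by rewrite expr0n (gtn_eqF q_gt0).
  rewrite [RHS]big_mkcond; apply: eq_bigr => v _.
  rewrite -scalerAl mcoeffZ mcoeffXM.
  have -> : ((v *+ q)%MM <= M)%MM = (v <= m)%MM.
    apply/mnm_lepP/mnm_lepP => h i; have := h i; rewrite mnmDE !mulmnE mnmE.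
      by rewrite -ltnS -addnS prednK // -mulSnr ltn_pmul2r.
    by move=> vmi; apply: leq_trans (leq_addr _ _); rewrite leq_mul2r vmi orbT.
  case: ifP => vm; last by rewrite mulr0.
  have E : (M - v *+ q)%MM = ((m - v) *+ q + c)%MM.
    apply/mnmP => i; rewrite !(mnmBE, mnmDE, mulmnE) mulnBl addnBAC //.
    by rewrite leq_mul2r (mnm_lepP vm) orbT.
  rewrite exprMn E !mcoeff_trunc -?E ?rtK //.
  - by rewrite E.
  - by apply: leq_ltn_trans md; apply/lem_mdeg/lem_subr.
  - by apply: leq_ltn_trans Md; apply/lem_mdeg/lem_subr.
pose trM := GRing.isLinear.Build _ _ _ _ tr trL.
pose tr' : {linear root_ring chS e -> S^o} := HB.pack tr trM.
exists tr' => l l_lt.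
pose L : 'X_{1..n} := [multinom l i | i < n].
have -> : \prod_i qroot chS e (mps_X k i) ^+ l i = qroot chS e (mps_monom L).
  rewrite (multinomUE_id L) mps_monom_sum rmorph_prod.
  apply: eq_bigr => i _; rewrite -mps_monomX rmorphXn mnmE.
  by [].
have rt0 : rt 0 = 0 by rewrite -[X in rt X](_ : 0 ^+ q = 0) ?rtX // expr0n (gtn_eqF q_gt0).
have rt1 : rt 1 = 1 by rewrite -[X in rt X](expr1n _ q) rtX.
apply: mpseriesP => m; rewrite -[LHS]/(rt ((m *+ q + c)%MM == L)%:R).
case: ifP => [/forallP lq|/negbT/forallPn[i li]].
  have -> : L = c by apply/mnmP => i; rewrite !mnmE; apply/eqP.
  rewrite -[X in _ == X]add0m eqm_add2r -[RHS]/((m == 0%MM)%:R).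
  suff -> : ((m *+ q)%MM == 0%MM) = (m == 0%MM) by case: eqP.
  apply/eqP/eqP => [/mnmP mq|->]; last by apply/mnmP => i; rewrite mulmnE mnm0E.
  apply/mnmP => i; have /eqP := mq i.
  by rewrite mulmnE !mnm0E muln_eq0 (gtn_eqF q_gt0) orbF => /eqP.
case: eqP => [/mnmP/(_ i)|_]; last exact: rt0.
rewrite mnmDE mulmnE !mnmE; case: (m i) => [|j].
  by rewrite mul0n add0n => E; rewrite E eqxx in li.
by move=> E; have := l_lt i; rewrite -E mulSn -addnA ltnNge leq_addr.
Qed.
End Existence.

(* Main.v *)
Require Import Defs.
From HB Require Import structures.
From mathcomp Require Import all_boot all_order all_algebra.
From mathcomp Require Import ring_quotient mpoly boolp classical_sets.

Set Implicit Arguments.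
Unset Strict Implicit.
Unset Printing Implicit Defensive.

Import Order.TTheory GRing.Theory.
Local Open Scope ring_scope.
Local Open Scope quotient_scope.
Local Open Scope classical_set_scope.

(** The proof is a computation with exponents.

    Write [Phi] for the trace twisted by [z = (x_1 ... x_n)^(q-1)].  Because
    the trace picks out the exponents congruent to [-1] modulo [q], and [z]
    shifts them by [q-1], the map [Phi] keeps exactly the terms whose exponents
    are divisible by [q]: the coefficient of [Phi s] at [m] is the [q]-th root
    of the coefficient of [s] at [q m] (lemma [twist_coef]).  In particular
    [Phi] sends multiples of [x_F] to multiples of [x_F], so each ideal
    [(x_F)], and hence the candidate ideal, is compatible.

    For the condition on minimal primes, let [P_F] be the prime generated by
    the variables outside [F].  A prime of [R] contains the image of [P_F] for
    some facet [F]: the variables outside the prime form a face, as their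
    product avoids the prime, and any facet above that face will do.  Therefore
    the minimal primes of [R] are the [P_F], [F] a facet
    ([prime_contains_facet_prime], [facet_prime_minimal]).  The sum of all
    [x_F] over the facets has coefficient 1 at [x_F], so it lies in no [P_F].

    Conversely let [J] be a compatible ideal with an element [c] outside all
    minimal primes, and [F] a facet.  Since [c] is not in [P_F], it has a term
    in the variables of [F] only, and [x_F c] is a multiple of [x_F] having a
    term [x^m] with support [F].  Multiplying by a monomial that rounds [m] up
    to a multiple of [q] and applying [Phi] replaces [m] by its quotient by
    [q], rounded up; iterating, one reaches an element of [J] that is a
    multiple of [x_F] with a nonzero term at [x_F].  Such an element is [x_F]
    times a unit of the power series ring, so [x_F] is in [J]
    ([XF_mem_compatible]). *)

(** * Coefficients and units of power series *)

Section SeriesArithmetic.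
Context {n : nat} {k : fieldType}.
Local Notation S := (mpseries n k).
Implicit Types (f g : S) (u v m : 'X_{1..n}).

Lemma mps_sumE (T : Type) (r : seq T) (P : pred T) (F : T -> S) m :
  (\sum_(i <- r | P i) F i) m = \sum_(i <- r | P i) F i m.
Proof. exact: (big_morph (fun f : S => f m)). Qed.

Lemma mps_mulE_sum f g m :
  (f * g) m = \sum_(u : 'X_{1..n < (mdeg m).+1} | (u <= m)%MM) f u * g (m - u)%MM.
Proof. by []. Qed.

Lemma mps_monom_mulE u f m :
  (mps_monom u * f) m = if (u <= m)%MM then f (m - u)%MM else 0.
Proof.
have md : (mdeg m < (mdeg m + mdeg u).+1)%N by rewrite ltnS leq_addr.
have ud : (mdeg u < (mdeg m + mdeg u).+1)%N by rewrite ltnS leq_addl.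
rewrite [LHS](mps_mulE _ _ md) mps_trunc_monom // mcoeffXM.
case: ifP => // um; rewrite mcoeff_trunc //.
by apply: leq_ltn_trans md; apply/lem_mdeg/lem_subr.
Qed.

(** Cancelling a monomial that divides every term of [f]. *)
Lemma mps_monom_div u f : (forall m, f m != 0 -> (u <= m)%MM) ->
  f = mps_monom u * MPSeries (fun m => f (m + u)%MM).
Proof.
move=> uf; apply: mpseriesP => m; rewrite mps_monom_mulE /=.
case: ifP => [um|/negP um]; first by rewrite submK.
by apply/eqP; apply: contra_notT um; apply: uf.
Qed.

Lemma mps_expr_low f j m : f 0%MM = 0 -> (mdeg m < j)%N -> (f ^+ j) m = 0.
Proof.
move=> f0; elim: j m => // j IHj m mj; rewrite exprS mps_mulE_sum big1 // => u um.
have [->|u0] := eqVneq (bmnm u) 0%MM; first by rewrite f0 mul0r.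
rewrite IHj ?mulr0 //; move: mj; rewrite -{1}(submK um) mdegD ltnS.
by apply: leq_trans; rewrite -[ltnLHS]addn0 ltn_add2l lt0n mdeg_eq0.
Qed.


(** In a monomial order, [a + b] is a sum of two monomials [u >= a], [v >= b]
    in one way only. *)
Lemma mps_mul_least f g a b :
    (forall u, (u < a)%O -> f u = 0) -> (forall v, (v < b)%O -> g v = 0) ->
  (f * g) (a + b)%MM = f a * g b.
Proof.
move=> fa gb; rewrite mps_mulE_sum.
have ab : (mdeg a < (mdeg (a + b)).+1)%N by rewrite ltnS mdegD leq_addr.
rewrite (bigD1 (BMultinom ab)) /=; last exact: lem_addr.
rewrite [X in g X](_ : _ = b); last by rewrite addmC addmK.
rewrite big1 ?addr0 // => -[u ud] /= /andP[uab]; rewrite -val_eqE /= => ua.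
have [/fa->|] := ltP u a; first by rewrite mul0r.
rewrite le_eqVlt eq_sym (negPf ua) /= => au.
rewrite (gb (_ - _)%MM) ?mulr0 //; rewrite ltNge; apply/negP => bu.
have := ltmc_le_add au bu.
by rewrite [(u + _)%MM]addmC submK // ltxx.
Qed.

Lemma mps_mul_coef0 f g : (f * g) 0%MM = f 0%MM * g 0%MM.
Proof. by rewrite -{1}[0%MM]addm0 mps_mul_least // => u; rewrite ltNge le0x. Qed.

Lemma mps_least f m : f m != 0 ->
  exists a, [/\ f a != 0, (a <= m)%O & forall u, (u < a)%O -> f u = 0].
Proof.
elim/(@ltmwf n): m => m IHm fm.
have [[u [um fu]]|no_smaller] := pselect (exists u, (u < m)%O /\ f u != 0).
  by have [a [fa am fa0]] := IHm u um fu; exists a; split=> //; apply: le_trans am (ltW um).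
exists m; split=> // u um; apply/eqP; apply: contra_notT no_smaller => fu.
by exists u.
Qed.

(** After normalising the constant term of [f] to be 1, [f = 1 - v] with
    [v 0 = 0], and the inverse is the geometric series in [v], of which only
    the powers up to the degree of [m] reach the coefficient at [m]. *)
Lemma mps_inverse f : f 0%MM != 0 -> exists g, g * f = 1.
Proof.
move=> f0.
pose c : S := MPSeries (fun m => if m == 0%MM then (f 0%MM)^-1 else 0).
pose v := 1 - c * f; pose geom d := \sum_(j < d) v ^+ j.
have v0 : v 0%MM = 0.
  rewrite -[LHS]/((1 : S) 0%MM - (c * f) 0%MM) mps_mul_coef0 /= !eqxx.
  by rewrite mulVf // subrr.
have geom_stable d m : (mdeg m < d)%N -> geom d m = geom (mdeg m).+1 m.
  move=> md; rewrite /geom !mps_sumE -(subnKC md) big_split_ord /=.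
  rewrite [X in _ + X]big1 ?addr0 // => j _.
  by rewrite mps_expr_low // addSn ltnS leq_addr.
exists (MPSeries (fun m => geom (mdeg m).+1 m) * c).
rewrite -mulrA (_ : c * f = 1 - v); last by rewrite subKr.
apply: mpseriesP => m; set d := (mdeg m).+1.
transitivity ((geom d * (1 - v)) m).
  rewrite !mps_mulE_sum; apply: eq_bigr => u um /=.
  by rewrite (geom_stable d) // ltnS lem_mdeg.
have -> : geom d * (1 - v) = 1 - v ^+ d.
  by rewrite mulrC -[in RHS](expr1n _ d) subrXX_comm ?/geom;
    [congr (_ * _); apply: eq_bigr => j _; rewrite expr1n mul1r|exact: mulrC].
by rewrite -[LHS]/((1 : S) m - (v ^+ d) m) mps_expr_low ?subr0.
Qed.

Definition mnm_set (F : {set 'I_n}) : 'X_{1..n} := [multinom (i \in F : nat) | i < n].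

Lemma mps_XF_monom (F : {set 'I_n}) : mps_XF k F = mps_monom (mnm_set F).
Proof.
rewrite (multinomUE_id (mnm_set F)) mps_monom_sum /mps_XF big_mkcond /=.
apply: eq_bigr => i _; rewrite -mps_monomX mnmE.
by case: (i \in F).
Qed.

(** An arbitrary series all of whose (infinitely many) terms are divisible by
    one of finitely many monomials is a finite combination of these: group the
    terms according to the first monomial of the list that divides them. *)
Lemma mps_monomial_mem (J : set S) (us : seq 'X_{1..n}) f :
    is_ideal J -> (forall u, u \in us -> J (mps_monom u)) ->
    (forall m, f m != 0 -> has (fun u => u <= m)%MM us) ->
  J f.
Proof.
move=> [J0 JD]; elim: us f => [|u us IHus] f Jus fus.
  suff -> : f = 0 by [].
  by apply: mpseriesP => m; apply/eqP; apply: contraT => /fus.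
pose f1 : S := MPSeries (fun m => if (u <= m)%MM then f m else 0).
pose f2 : S := MPSeries (fun m => if (u <= m)%MM then 0 else f m).
have -> : f = f1 + f2.
  by apply: mpseriesP => m /=; case: ifP; rewrite ?addr0 ?add0r.
have -> : f1 = mps_monom u * MPSeries (fun m => f1 (m + u)%MM).
  by apply: mps_monom_div => m /=; case: ifP => //; rewrite eqxx.
rewrite mulrC; apply: JD; first by apply: Jus; rewrite inE eqxx.
apply: IHus => [w wus|m /=]; first by apply: Jus; rewrite inE wus orbT.
by case: ifP => [|um /fus /=]; rewrite ?eqxx // um.
Qed.

End SeriesArithmetic.

(** * Minimal primes of a Stanley-Reisner ring *)

Section PrimeIdeals.
Context {A : comNzRingType}.

Lemma is_idealM (J : set A) a x : is_ideal J -> J x -> J (a * x).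
Proof. by move=> [J0 JD] Jx; rewrite -[_ * _]addr0; apply: JD. Qed.

Lemma is_prime_prod (P : set A) (T : finType) (F : {set T}) (x : T -> A) :
  is_prime P -> P (\prod_(i in F) x i) -> exists2 i, i \in F & P (x i).
Proof.
move=> [_ P1 PM]; apply: contraPP => noF.
apply: (big_rec (fun y => ~ P y)) => // i y iF Py.
by case/PM => // xi; apply: noF; exists i.
Qed.

Lemma is_ideal_preimage (B : comNzRingType) (f : {rmorphism A -> B}) (J : set B) :
  is_ideal J -> is_ideal (f @^-1` J).
Proof.
move=> [J0 JD]; split=> [|a x y]; first by rewrite /= rmorph0.
by rewrite /= rmorphD rmorphM; apply: JD.
Qed.

Lemma is_prime_preimage (B : comNzRingType) (f : {rmorphism A -> B}) (P : set B) :
  is_prime P -> is_prime (f @^-1` P).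
Proof.
move=> [PI P1 PM]; split; first exact: is_ideal_preimage.
  by rewrite /= rmorph1.
by move=> x y; rewrite /= rmorphM; apply: PM.
Qed.

End PrimeIdeals.

Section FacePrimes.
Context {n : nat} {k : fieldType}.
Local Notation S := (mpseries n k).
Implicit Types (f g : S) (u v m : 'X_{1..n}) (F G : {set 'I_n}).

Definition supported F m := [forall i, (i \notin F) ==> (m i == 0%N)].

Lemma supportedP F m :
  reflect (forall i, i \notin F -> m i = 0%N) (supported F m).
Proof.
apply: (iffP forallP) => [h i iF|h i]; first by apply/eqP/(implyP (h i)).
by apply/implyP => /h ->.
Qed.

Lemma supported_le F u m : (u <= m)%MM -> supported F m -> supported F u.
Proof.
move=> /mnm_lepP um /supportedP mF; apply/supportedP => i iF.
by apply/eqP; rewrite -leqn0 -(mF i iF).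
Qed.

Lemma supportedD F u v : supported F (u + v) = supported F u && supported F v.
Proof.
apply/supportedP/andP => [uv|[/supportedP uF /supportedP vF] i iF].
  by split; apply/supportedP => i iF; have /eqP := uv i iF;
    rewrite mnmDE addn_eq0 => /andP[/eqP ? /eqP ?].
by rewrite mnmDE uF ?vF.
Qed.

Lemma supported_mnm_set F : supported F (mnm_set F).
Proof. by apply/supportedP => i iF; rewrite mnmE (negPf iF). Qed.

(** The prime generated by the variables outside [F], presented as the kernel
    of setting these variables to zero. *)
Definition face_prime F : set S := [set f | forall m, supported F m -> f m = 0].

(** Two series that survive setting the variables outside [F] to zero have
    least surviving terms, and the product of these is a surviving term of the
    product. *)
Lemma face_prime_is_prime F : is_prime (face_prime F).
Proof.
split.
- split=> [|a f g fF gF] m mF //; rewrite -[LHS]/((a * f) m + g m) gF // addr0.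
  rewrite mps_mulE_sum big1 // => u um; rewrite fF ?mulr0 //.
  exact: supported_le (lem_subr _ _) mF.
- move=> /(_ 0%MM) h; have : (1 : S) 0%MM = 0.
    by apply: h; apply/supportedP => i; rewrite mnm0E.
  by rewrite /= eqxx => /eqP; rewrite oner_eq0.
move=> f g fgF.
pose res (h : S) : S := MPSeries (fun m => if supported F m then h m else 0).
have resM m : supported F m -> (f * g) m = (res f * res g) m.
  move=> mF; rewrite !mps_mulE_sum; apply: eq_bigr => u um /=.
  by rewrite (supported_le um mF) (supported_le (lem_subr _ _) mF).
have least h : ~ face_prime F h -> exists a,
    [/\ supported F a, res h a != 0 & forall u, (u < a)%O -> res h u = 0].
  move=> hF; have [m hm] : exists m, res h m != 0.
    apply/not_existsP => res0; apply: hF => m mF.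
    by have /negP/negPn/eqP := res0 m; rewrite /= mF.
  have [a [ha _ la]] := mps_least hm; exists a; split=> //.
  by move: ha => /=; case: ifP => //; rewrite eqxx.
have [?|/least[a [aF fa la]]] := pselect (face_prime F f); first by left.
have [?|/least[b [bF gb lb]]] := pselect (face_prime F g); first by right.
have abF : supported F (a + b) by rewrite supportedD aF.
have /eqP := fgF _ abF; rewrite resM // mps_mul_least //.
by rewrite mulf_eq0 (negPf fa) (negPf gb).
Qed.

Lemma face_prime_X F i : face_prime F (mps_X k i) <-> i \notin F.
Proof.
split=> [XF|iF m /supportedP mF].
  apply/negP => iF; have : mps_X k i U_(i)%MM = 0.
    apply: XF; apply/supportedP => j jF.
    by rewrite mnm1E; case: eqP => // E; rewrite E (negPf jF) in iF.
  by rewrite /= eqxx => /eqP; rewrite oner_eq0.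
rewrite /=; case: eqP => // E; have := mF i iF.
by rewrite E mnm1E eqxx.
Qed.

Lemma face_prime_XF F G : face_prime F (mps_XF k G) <-> ~~ (G \subset F).
Proof.
have PF := face_prime_is_prime F; have [idF _ _] := PF.
split=> [/(is_prime_prod PF)[i iG /face_prime_X iF]|/subsetPn[i iG iF]].
  by apply/subsetPn; exists i.
rewrite /mps_XF (bigD1 i) //= mulrC; apply: (is_idealM _ idF).
exact/face_prime_X.
Qed.

(** Each of the terms of a series in [face_prime F] is divisible by one of the
    finitely many variables outside [F]. *)
Lemma face_prime_sub F (Q : set S) : is_ideal Q ->
  (forall i, i \notin F -> Q (mps_X k i)) -> face_prime F `<=` Q.
Proof.
move=> QI XQ f fF.
apply: (mps_monomial_mem (us := [seq U_(i)%MM | i <- enum (~: F)])) => //.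
  by move=> u /mapP[i]; rewrite mem_enum inE => iF ->; apply: XQ.
move=> m fm; have /forallPn[i] : ~~ supported F m.
  by apply: contraNN fm => /fF ->.
rewrite negb_imply => /andP[iF mi]; apply/hasP; exists U_(i)%MM.
  by apply/map_f; rewrite mem_enum inE.
by rewrite lep1mP.
Qed.

End FacePrimes.

Section QuotientPrimes.
Context {n : nat} {k : fieldType} (I : idealr (mpseries n k)).
Context (sqI : squarefree_monomial_ideal [set` I]).
Local Notation S := (mpseries n k).
Local Notation R := {ideal_quot I}.
Implicit Types (F G : {set 'I_n}).

Lemma pi_eq0 (f : S) : (\pi_R f = 0) <-> f \in I.
Proof.
rewrite -(subr0 f) Quotient.idealrBE subr0 -(rmorph0 (\pi_R : {rmorphism _ -> _})).
by split=> /eqP.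
Qed.

Lemma is_face_sub F G : F \subset G -> is_face I G -> is_face I F.
Proof.
move=> FG; apply: contra; rewrite /mps_XF => FI.
rewrite (big_setID F) /= (finset.setIidPr FG) mulrC.
exact: idealMr.
Qed.

(** A generator [x_G] of [I] involves a variable outside each face. *)
Lemma ideal_sub_face_prime F : is_face I F -> [set` I] `<=` face_prime F.
Proof.
case: sqI => gens IE IF; rewrite IE; apply: smallest_sub.
  by case: (@face_prime_is_prime n k F).
move=> _ [G Ggens <-]; apply/face_prime_XF.
apply/negP => GF; have /negP := is_face_sub GF IF; apply.
have : gen_ideal [set mps_XF k F | F in gens] (mps_XF k G).
  by apply: sub_gen_ideal; exists G.
by rewrite -IE.
Qed.

Definition face_prime_quot F : set R := [set \pi_R f | f in face_prime F].

Lemma face_prime_quotE F f :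
  is_face I F -> face_prime_quot F (\pi_R f) <-> face_prime F f.
Proof.
move=> IF; split=> [[g gF /eqP]|fF]; last by exists f.
rewrite -Quotient.idealrBE => /(ideal_sub_face_prime IF) gfF m mF.
have := gfF m mF; rewrite -[LHS]/(g m - f m) gF // sub0r => /eqP.
by rewrite oppr_eq0 => /eqP.
Qed.

Lemma face_prime_quot_is_prime F : is_face I F -> is_prime (face_prime_quot F).
Proof.
move=> IF; have [[P0 PD] P1 PM] := @face_prime_is_prime n k F.
split.
- split=> [|a x y]; first by exists 0; rewrite ?rmorph0.
  rewrite -(reprK a) -(reprK x) -(reprK y) -rmorphM -rmorphD.
  by rewrite !face_prime_quotE //; apply: PD.
- by rewrite -(rmorph1 (\pi_R : {rmorphism _ -> _})) face_prime_quotE.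
move=> x y; rewrite -(reprK x) -(reprK y) -rmorphM !face_prime_quotE //.
exact: PM.
Qed.

(** The variables outside a prime form a face, since their product avoids the
    prime; the prime then contains all variables outside any larger facet. *)
Lemma prime_contains_facet_prime (P : set R) : is_prime P ->
  exists2 F, is_facet I F & face_prime_quot F `<=` P.
Proof.
move=> primeP; have primeP' := is_prime_preimage (\pi_R : {rmorphism _ -> _}) primeP.
pose F0 := [set i | `[< ~ P (\pi_R (mps_X k i)) >]]%SET.
have face0 : is_face I F0.
  apply/negP => /pi_eq0 F00; have [[P0 _] _ _] := primeP.
  have /(is_prime_prod primeP')[i] : P (\pi_R (mps_XF k F0)) by rewrite F00.
  by rewrite inE => /asboolP.
have [F facetF subF] := maxset_exists face0; exists F => // _ [f fF <-].
have [idP' _ _] := primeP'.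
apply: (face_prime_sub idP' _ fF) => i; apply: contraNP => Xi.
by apply: (fintype.subsetP subF); rewrite inE; apply/asboolP.
Qed.

(** A smaller prime would contain the prime of another facet, and inclusions
    of these primes reverse inclusions of facets. *)
Lemma facet_prime_minimal F : is_facet I F -> is_minimal_prime (face_prime_quot F).
Proof.
move=> /maxsetP[faceF maxF]; split; first exact: face_prime_quot_is_prime.
move=> Q primeQ QF; have [G /maxsetp faceG GQ] := prime_contains_facet_prime primeQ.
suff FG : F \subset G by rewrite -(maxF G).
apply/fintype.subsetP => i iF; apply/negPn/negP => iG.
have : face_prime_quot F (\pi_R (mps_X k i)).
  by apply: QF; apply: GQ; exists (mps_X k i) => //; apply/face_prime_X.
by rewrite face_prime_quotE // face_prime_X iF.
Qed.

End QuotientPrimes.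

(** * The trace map in coordinates *)

Section TraceMap.
Context {n : nat} {k : fieldType} {p : nat} (chk : p \in [pchar k]) (e : nat).
Local Notation S := (mpseries n k).
Local Notation q := (p ^ e)%N.
Local Notation chS := (mps_pchar n chk).
Implicit Types (f g s : S) (u v m : 'X_{1..n}).

Lemma q_gt0 : (0 < q)%N.
Proof. by rewrite expn_gt0 prime_gt0 // (pcharf_prime chk). Qed.

Lemma q_gt1 : (0 < e)%N -> (1 < q)%N.
Proof. by move=> e0; rewrite -(exp1n e) ltn_exp2r // prime_gt1 // (pcharf_prime chk). Qed.

Lemma perfect_root : perfect_char p k -> forall a : k, exists b, b ^+ q = a.
Proof.
move=> perf; elim: e => [|j IHj] a; first by exists a; rewrite expn0.
have [b <-] := perf a; have [c <-] := IHj b.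
by exists c; rewrite expnSr exprM.
Qed.

Lemma mulm_q_inj : injective (fun v : 'X_{1..n} => (v *+ q)%MM).
Proof.
move=> u v /mnmP uv; apply/mnmP => i; have /eqP := uv i.
by rewrite !mulmnE eqn_pmul2r ?q_gt0 // => /eqP.
Qed.

Lemma mps_exprq_coef s m : (s ^+ q) (m *+ q)%MM = s m ^+ q.
Proof.
have mmq : (mdeg m <= mdeg (m *+ q))%N by rewrite mdegMn leq_pmulr ?q_gt0.
rewrite (mps_exprE _ _ (ltnSn _)) (mps_truncXq chk) raddf_sum /=.
rewrite (bigD1 (BMultinom (mmq : (mdeg m < _.+1)%N))) //= mcoeffZ mcoeffX eqxx mulr1.
rewrite big1 ?addr0 // => v; rewrite -val_eqE /= => vm.
by rewrite mcoeffZ mcoeffX (inj_eq mulm_q_inj) (negPf vm) mulr0.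
Qed.

Lemma mps_exprq_supp s m : (s ^+ q) m != 0 -> exists v, m = (v *+ q)%MM.
Proof.
apply: contra_neqP => no_root.
rewrite (mps_exprE _ _ (ltnSn _)) (mps_truncXq chk) raddf_sum /= big1 // => v _.
rewrite mcoeffZ mcoeffX; case: eqP => [E|]; last by rewrite mulr0.
by case: no_root; exists v.
Qed.

Definition mnm_top : 'X_{1..n} := [multinom q.-1 | i < n].

Lemma mps_X_topE : (\prod_(i < n) mps_X k i) ^+ q.-1 = mps_monom mnm_top.
Proof.
rewrite (multinomUE_id mnm_top) mps_monom_sum -prodrXl.
by apply: eq_bigr => i _; rewrite mps_monomX mnmE.
Qed.

(** Freeness of [S^{1/q}]: the terms of a series are sorted by their exponents
    modulo [q], and each class is a [q]-th power times a basis monomial because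
    the coefficients have [q]-th roots. *)
Lemma root_ring_decomp (t : root_ring chS e) (rt : k -> k) :
    (forall a, rt a ^+ q = a) ->
  t = \sum_(l : {ffun 'I_n -> 'I_q})
    (MPSeries (fun m => rt (unqroot t (m *+ q + [multinom (l i : nat) | i < n])%MM)) : S)
       *: qroot chS e (mps_monom [multinom (l i : nat) | i < n]).
Proof.
move=> rtK; pose lam (l : {ffun 'I_n -> 'I_q}) := [multinom (l i : nat) | i < n].
pose b l : S := MPSeries (fun m => rt (unqroot t (m *+ q + lam l)%MM)).
change ((t : S) = \sum_(l : {ffun 'I_n -> 'I_q}) b l ^+ q * mps_monom (lam l)).
apply: mpseriesP => m; rewrite mps_sumE.
have termE l : (b l ^+ q * mps_monom (lam l)) m
    = if (lam l <= m)%MM then (b l ^+ q) (m - lam l)%MM else 0.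
  by rewrite mulrC mps_monom_mulE.
rewrite (eq_bigr _ (fun l _ => termE l)) {termE}.
(* Only the class of the residue of [m] contributes to the coefficient at [m]. *)
pose l0 : {ffun 'I_n -> 'I_q} := [ffun i => Ordinal (ltn_pmod (m i) q_gt0)].
pose v0 : 'X_{1..n} := [multinom (m i %/ q)%N | i < n].
have mE : m = (v0 *+ q + lam l0)%MM.
  by apply/mnmP => i; rewrite mnmDE mulmnE !mnmE ffunE /= -divn_eq.
rewrite (bigD1 l0) // big1 ?addr0 => [|l ll0].
  have -> : (lam l0 <= m)%MM by rewrite mE lem_addl.
  have -> : (m - lam l0 = v0 *+ q)%MM by rewrite {1}mE addmK.
  by rewrite mps_exprq_coef [RHS]addr0 [RHS]rtK -mE.
apply/eqP; apply: contraNT ll0.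
case: ifP => [lm|]; last by rewrite eqxx.
move=> /mps_exprq_supp[v /mnmP vE]; apply/eqP/ffunP => i; apply: val_inj.
rewrite ffunE /=; have := vE i; rewrite mnmBE mulmnE mnmE => E.
rewrite -(subnK (mnm_lepP lm i)) mnmE.
by rewrite E modnMDl modn_small.
Qed.

Section Twist.
Context (PhiS : {linear root_ring chS e -> S^o}).
Context (perf : perfect_char p k) (hPhiS : is_trace PhiS).
Local Notation Phi := (twist PhiS ((\prod_(i < n) mps_X k i) ^+ q.-1)).

(** The coordinate of [t] on the basis element sent to 1 collects the terms
    with all exponents congruent to [-1] modulo [q]. *)
Lemma trace_coef (t : root_ring chS e) m :
  (PhiS t : S) m ^+ q = unqroot t (m *+ q + mnm_top)%MM.
Proof.
have [rt rtK] := choice (perfect_root perf).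
have top_lt : (q.-1 < q)%N by rewrite prednK ?q_gt0.
pose l0 : {ffun 'I_n -> 'I_q} := [ffun => Ordinal top_lt].
have PhiE (l : {ffun 'I_n -> 'I_q}) :
    PhiS (qroot chS e (mps_monom [multinom (l i : nat) | i < n])) = (l == l0)%:R.
  have -> : qroot chS e (mps_monom [multinom (l i : nat) | i < n])
      = \prod_i qroot chS e (mps_X k i) ^+ (l i).
    rewrite (multinomUE_id [multinom _ | i < n]) mps_monom_sum rmorph_prod.
    by apply: eq_bigr => i _; rewrite -mps_monomX rmorphXn mnmE.
  rewrite hPhiS //; suff -> : [forall i, l i == q.-1 :> nat] = (l == l0) by case: eqP.
  apply/forallP/eqP => [lq|-> i]; last by rewrite ffunE.
  by apply/ffunP => i; apply: val_inj; rewrite ffunE /=; apply/eqP.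
rewrite [in LHS](root_ring_decomp t rtK) linear_sum (bigD1 l0) // big1 => [|l ll0].
  rewrite Monoid.mulm1 (linearZ_LR PhiS) PhiE eqxx -[_ *: _]/(_ * 1) mulr1 /= rtK.
  by congr (unqroot t (_ + _)%MM); apply/mnmP => i; rewrite !mnmE ffunE.
by rewrite (linearZ_LR PhiS) PhiE (negPf ll0) -[_ *: _]/(_ * 0) mulr0.
Qed.

(** The twist by [z] shifts the trace so that it merely keeps the exponents
    divisible by [q]: it sends the root of [a^q x^(q m)] to [a x^m], killing the rest. *)
Lemma twist_coef s m : Phi (qroot chS e s) m ^+ q = s (m *+ q)%MM.
Proof.
rewrite /twist trace_coef mps_X_topE -[LHS]/((mps_monom mnm_top * s) (m *+ q + mnm_top)%MM).
by rewrite mps_monom_mulE lem_addl addmK.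
Qed.

(** The exponents [m] and [q m] have the same support. *)
Lemma twist_divisible (F : {set 'I_n}) s :
    (forall m, s m != 0 -> (mnm_set F <= m)%MM) ->
  forall m, Phi (qroot chS e s) m != 0 -> (mnm_set F <= m)%MM.
Proof.
move=> Fs m Pm; have /Fs/mnm_lepP Fmq : s (m *+ q)%MM != 0.
  by rewrite -twist_coef expf_neq0.
apply/mnm_lepP => i; have := Fmq i; rewrite mulmnE !mnmE.
by case: (i \in F); rewrite // muln_gt0 => /andP[].
Qed.

Lemma divn_ceilS a : ((a.+1 + q.-1) %/ q)%N = (a %/ q).+1.
Proof. by rewrite addSnnS prednK ?q_gt0 // divnDr // divnn q_gt0 addn1. Qed.

(** If [f] in [J] has a term [x^m] with support [F], multiply it by the monomial
    that rounds [m] up to a multiple of [q] and apply [Phi]: the exponents of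
    the term get divided by [q], rounding up.  As [q > 1], this descent stops
    only when the exponents on [F] are all 1, and then [f] is [x_F] times a
    unit.  Divisibility by [x_F] is carried along to conclude this. *)
Lemma XF_mem_compatible (J : set S) (F : {set 'I_n}) f m :
    (0 < e)%N -> is_ideal J -> (forall s, J s -> J (Phi (qroot chS e s))) ->
    (forall u, f u != 0 -> (mnm_set F <= u)%MM) ->
    J f -> f m != 0 -> supported F m ->
  J (mps_XF k F).
Proof.
move=> e_gt0 JI JPhi; have [d] := ubnP (mdeg m).
elim: d m f => // d IHd m f; rewrite ltnS => md Ff Jf fm mF.
have [mE|m_neq] := eqVneq m (mnm_set F).
  have [|g gf] := mps_inverse (f := MPSeries (fun m => f (m + mnm_set F)%MM)).
    by rewrite /= add0m -mE.
  have -> : mps_XF k F = g * f.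
    by rewrite [in RHS](mps_monom_div Ff) mulrCA gf mulr1 mps_XF_monom.
  exact: is_idealM.
pose m1 : 'X_{1..n} := [multinom ((m i + q.-1) %/ q)%N | i < n].
have m1_le : (m1 <= m)%MM.
  apply/mnm_lepP => i; rewrite mnmE; case: (m i) => [|a].
    by rewrite divn_small // add0n prednK ?q_gt0.
  by rewrite divn_ceilS ltnS leq_div.
have m_le : (m <= m1 *+ q)%MM.
  apply/mnm_lepP => i; rewrite mulmnE mnmE; case: (m i) => [|a] //.
  by rewrite divn_ceilS ltn_ceil ?q_gt0.
have m1_neq : m1 != m.
  apply: contraNneq m_neq => /mnmP m1E; apply/eqP/mnmP => i.
  have := m1E i; have /mnm_lepP/(_ i) := Ff m fm; rewrite !mnmE.
  have [iF|/(supportedP _ _ mF)-> //] := boolP (i \in F).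
  case: (m i) => // a _; rewrite divn_ceilS => -[aq].
  case: a aq => // a aq; have := ltn_Pdiv (q_gt1 e_gt0) (ltn0Sn a).
  by rewrite aq ltnn.
apply: (IHd m1 (Phi (qroot chS e (mps_monom (m1 *+ q - m)%MM * f)))).
- apply: leq_trans md; rewrite -[X in (_ < mdeg X)%N](submK m1_le) mdegD.
  rewrite -[ltnLHS]add0n ltn_add2r lt0n mdeg_eq0; apply: contraNneq m1_neq => E.
  by rewrite -(submK m1_le) E add0m.
- apply: twist_divisible => u; rewrite mps_monom_mulE.
  case: ifP => [_ /Ff Fu|]; last by rewrite eqxx.
  exact: lepm_trans Fu (lem_subr _ _).
- by apply: JPhi; apply: is_idealM.
- apply: contraNneq fm => Pm1; have := twist_coef (mps_monom (m1 *+ q - m)%MM * f) m1.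
  rewrite Pm1 expr0n gtn_eqF ?q_gt0 // mps_monom_mulE lem_subr.
  by rewrite submBA // addmC addmK => <-.
- exact: supported_le m1_le mF.
Qed.

End Twist.
End TraceMap.

(** * The test ideal *)

Theorem proposition3p10 (k : fieldType) (p : nat) (chk : p \in [pchar k])
    (perf : perfect_char p k) (n e : nat) (he : (1 <= e)%N)
    (I : idealr (mpseries n k)) (hI : squarefree_monomial_ideal [set` I])
    (PhiS : {linear root_ring (mps_pchar n chk) e -> (mpseries n k)^o})
    (hPhiS : is_trace PhiS)
    (phi : {linear root_ring (quot_pchar (mps_pchar n chk) I) e ->
              {ideal_quot I}^o})
    (hphi : is_quotient_map
              (twist PhiS ((\prod_(i < n) mps_X k i) ^+ (p ^ e).-1)) phi) :
  is_test_ideal phi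
    (gen_ideal [set \pi_{ideal_quot I} (mps_XF k F) | F in is_facet I]).
Proof.
set tau := gen_ideal _; set Phi := twist _ _ in hphi.
pose piR : {rmorphism mpseries n k -> {ideal_quot I}} := \pi_{ideal_quot I}.
have [_ phiE] := hphi.
have tau_ideal : is_ideal tau by apply: gen_ideal_is_ideal.
have tau_facet F : is_facet I F -> tau (piR (mps_XF k F)).
  by move=> FI; apply: sub_gen_ideal; exists F.
split; first split=> //.
- move=> _ [_ [x tx <-] <-].
  (* Additivity of [phi] only gives the claim on sums; quantifying over the
     multiplier [a] makes the set of good [x] an ideal. *)
  pose K : set {ideal_quot I} := [set x | forall a, tau (phi (qroot _ e (a * x)))].
  suff /(_ x tx 1) : tau `<=` K by rewrite mul1r.
  apply: smallest_sub.
    split=> [a|b y z yK zK a]; first by rewrite mulr0 rmorph0 linear0; case: tau_ideal.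
    rewrite mulrDr rmorphD linearD mulrA.
    by have := tau_ideal.2 1 _ _ (yK (a * b)) (zK a); rewrite mul1r.
  move=> _ [F FI <-] a; rewrite -(reprK a) -rmorphM.
  set s := repr a * mps_XF k F.
  rewrite -[qroot _ _ _]/(root_proj I (qroot (mps_pchar n chk) e s)) phiE.
  have divs m : s m != 0 -> (mnm_set F <= m)%MM.
    rewrite /s mulrC mps_XF_monom mps_monom_mulE.
    by case: ifP => //; rewrite eqxx.
  rewrite /Phi (mps_monom_div (twist_divisible perf hPhiS divs)) -mps_XF_monom mulrC.
  by rewrite rmorphM; apply: (is_idealM _ tau_ideal); apply: tau_facet.
- exists (piR (\sum_(F | is_facet I F) mps_XF k F)); split.
    rewrite rmorph_sum; have [t0 tD] := tau_ideal.
    apply: (big_ind tau) => // x y tx ty.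
    by rewrite -[x]mul1r; apply: tD.
  move=> P [primeP minP] Pc.
  have [F FI FP] := prime_contains_facet_prime primeP.
  have faceF := maxsetp FI.
  have := minP _ (face_prime_quot_is_prime hI faceF) FP _ Pc.
  rewrite /piR face_prime_quotE // => c0.
  have one_at_F : (\sum_(G | is_facet I G) mps_XF k G) (mnm_set F) = 1.
    rewrite mps_sumE (bigD1 F) //= big1 => [|G /andP[_ GF]].
      by rewrite addr0 mps_XF_monom /= eqxx.
    rewrite mps_XF_monom /=; case: eqP => // /mnmP E; case/eqP: GF.
    apply/setP => i; have := E i; rewrite !mnmE.
    by case: (i \in F); case: (i \in G).
  have /eqP := c0 _ (supported_mnm_set F); by rewrite one_at_F oner_eq0.
move=> J [JI Jphi [c [Jc c_min]]]; apply: smallest_sub => // _ [F FI <-].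
have faceF := maxsetp FI.
have /= := c_min _ (facet_prime_minimal hI FI).
rewrite -(reprK c) face_prime_quotE // => /existsNP[m /not_implyP[mF /eqP cm]].
have J'I := is_ideal_preimage piR JI.
apply: (@XF_mem_compatible n k p chk e PhiS perf hPhiS (piR @^-1` J) F
  (mps_monom (mnm_set F) * repr c) (mnm_set F + m)%MM) => //.
- move=> s Js; rewrite /= -/Phi -[piR _]phiE; apply: Jphi.
  by exists (piR s); eexists; [exact: Js|].
- by move=> u; rewrite mps_monom_mulE; case: ifP => //; rewrite eqxx.
- by apply: is_idealM => //=; rewrite reprK.
- by rewrite mps_monom_mulE lem_addr addmC addmK.
- by rewrite supportedD mF supported_mnm_set.
Qed.
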